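(* Let $N=\prod_{j=1}^r p_j^{k_j}\geq 2$, where $p_1,\dots,p_r$ are the pairwise distinct prime factors of $N$ (all $k_j\ge1$). Then for all $m\in\mathbb{N}$ we have $$\sum_{\substack{1\le i<N\\ \gcd(N,i)=1}}\sigma^i_1(m)-\varphi(N)\sigma^0_1(m)=\sum_{I\subseteq\{1,\dots,r\}}\left(\prod_{t\in I}\varphi(p_t^{k_t})\prod_{s\notin I}p_s^{k_s}\sum_{\substack{1\le i<N\\ p_t\mid i\ \forall t\in I,\ p_s\nmid i\ \forall s\notin I}}\kappa^i_1(m)\right).$$
   Context: $\varphi$ is Euler's totient function and $\eta=e^{2\pi i/N}$ (here $i=\sqrt{-1}$). For $a\in\mathbb{Z}/N\mathbb{Z}$ and $m\in\mathbb{N}$, $$\sigma_1^a(m)=\sum_{nu=m}\eta^{au}u,\qquad \kappa_1^a(m)=\sum_{nu=m}\eta^{au}n,$$ the sums being over pairs of positive integers $(n,u)$ with $nu=m$. *)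

(* Defs.v *)
From HB Require Import structures.
From mathcomp Require Import all_boot all_order all_algebra.
From mathcomp Require Import complex.
From mathcomp Require Import reals trigo sequences exp.

Set Implicit Arguments.
Unset Strict Implicit.
Unset Printing Implicit Defensive.

Import Order.TTheory GRing.Theory Num.Theory.

Local Open Scope ring_scope.
Local Open Scope complex_scope.

Definition cexp (R : realType) (z : R[i]) : R[i] :=
  (expR (complex.Re z))%:C * (cos (complex.Im z) +i* sin (complex.Im z)).

Definition eta (R : realType) (N : nat) : R[i] :=
  cexp ((2 * pi)%:C * 'i / N%:R).

(* The two definitions below are meant for 1 < N only, since 'Z_N is Z/NZ just
   in that case; the exponent a * u is computed with the representative
   0 <= a < N, which is immaterial as eta ^+ N = 1.  The pairs (n, u) of
   positive integers with n * u = m all satisfy n, u <= m. *)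

Definition sigma1 (R : realType) (N : nat) (a : 'Z_N) (m : nat) : R[i] :=
  \sum_(1 <= n < m.+1) \sum_(1 <= u < m.+1 | (n * u)%N == m)
    eta R N ^+ (a * u) * u%:R.

Definition kappa1 (R : realType) (N : nat) (a : 'Z_N) (m : nat) : R[i] :=
  \sum_(1 <= n < m.+1) \sum_(1 <= u < m.+1 | (n * u)%N == m)
    eta R N ^+ (a * u) * n%:R.

(* Main.v *)
Require Import Defs.
From mathcomp Require Import all_boot all_order all_algebra.
From mathcomp Require Import complex.
From mathcomp Require Import unstable reals sequences exp trigo.
From mathcomp Require Import ring lra.

Set Implicit Arguments.
Unset Strict Implicit.
Unset Printing Implicit Defensive.

Import Order.TTheory GRing.Theory Num.Theory.

Local Open Scope ring_scope.

(** For [J] a set of indices put [D J = N / \prod_(t in J) p t].  Expanding a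
    weight [\prod_t (a t - b t * [p t %| i])] over [J] and summing the unity
    roots [z ^+ (i * u)] over the multiples [i < N] of [\prod_(t in J) p t]
    gives [\sum_J c J * D J * [D J %| u]].  The choice [a = b = 1] is the
    indicator of [coprime N i], and [a t = p t ^ k t], [b t = p t ^ (k t).-1]
    is the weight on the right-hand side; its coefficients [c J] are those of
    the former times [D J].  This extra factor is the one produced by
    [\sum_(n u = m, d %| u) u = d * \sum_(n u = m, d %| u) n].  The term
    [i = 0] missing on the right is [totient N * kappa^0], and
    [kappa^0 = sigma^0]. *)

(** * Powers of [eta] and sums of roots of unity *)

Lemma etaX (R : realType) (N n : nat) : (0 < N)%N ->
  eta R N ^+ n
  = Complex (cos (n%:R * (2 * pi / N%:R))) (sin (n%:R * (2 * pi / N%:R))).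
Proof.
move=> N0.
have etaE : eta R N = Complex (cos (2 * pi / N%:R)) (sin (2 * pi / N%:R)).
  have -> : eta R N = cexp (Complex 0 (2 * pi / N%:R)).
    rewrite /eta; congr cexp.
    have -> : (N%:R : R[i]) = (N%:R : R)%:C%C by rewrite rmorph_nat.
    rewrite -fmorphV /=.
    by apply/eqP; rewrite eq_complex /=; apply/andP; split; apply/eqP; ring.
  rewrite /cexp /= expR0.
  by apply/eqP; rewrite eq_complex /=; apply/andP; split; apply/eqP; ring.
elim: n => [|n IH]; first by rewrite expr0 mul0r cos0 sin0.
rewrite exprS IH etaE; set y := 2 * pi / _.
rewrite (_ : n.+1%:R * y = n%:R * y + y) ?cosD ?sinD; last first.
  by rewrite -natr1 mulrDl mul1r.
by apply/eqP; rewrite eq_complex /=; apply/andP; split; apply/eqP; ring.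
Qed.

(** For [0 < j < N] the real part of [eta ^+ j] is [1 - 2 * sin x ^+ 2] with [x = pi * j / N]
    strictly between 0 and [pi], so it differs from 1. *)
Lemma eta_primitive (R : realType) (N : nat) : (0 < N)%N ->
  N.-primitive_root (eta R N).
Proof.
move=> N0; have NR0 : (0 : R) < N%:R by rewrite ltr0n.
have etaN : eta R N ^+ N = 1.
  rewrite etaX // mulrC divfK ?gt_eqF // mulrC mulr_natr.
  by rewrite cos2pi sin2pi.
apply/andP; split=> //; apply/forallP=> i; rewrite unity_rootE; apply/eqP.
have [->|iN] := eqVneq i.+1 N; first by rewrite etaN eqxx.
have {}iN : (i.+1 < N)%N by rewrite ltn_neqAle iN ltn_ord.
apply/negbTE; rewrite etaX // eq_complex negb_and; apply/orP; left.
set x := _ * _; have -> : x = (i.+1%:R / N%:R * pi) *+ 2.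
  by rewrite /x -mulr_natl; ring.
rewrite cos_mulr2n cos2sin2 /= (_ : _ == _ = (sin (i.+1%:R / N%:R * pi) ^+ 2 == 0 :> R)).
  rewrite sqrf_eq0 gt_eqF // sin_gt0_pi // mulr_gt0 ?pi_gt0 ?divr_gt0 ?ltr0n //=.
  by rewrite gtr_pMl ?pi_gt0 // ltr_pdivrMr // mul1r ltr_nat.
by apply/eqP/eqP; lra.
Qed.

(** Only the indices [P * j] with [j < d] survive, which leaves a geometric sum of ratio
    [z ^+ (P * u)]. As [z] has order [P * d], the ratio is 1 exactly when [d %| u]; otherwise its
    [d]-th power is still 1, so the sum vanishes. *)
Lemma sum_unity_root_multiples (F : fieldType) (N P d u : nat) (z : F) :
  N.-primitive_root z -> N = (P * d)%N ->
  \sum_(0 <= i < N) (P %| i)%:R * z ^+ (i * u) = (d %| u)%:R * d%:R.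
Proof.
move=> zN NE; have := prim_order_gt0 zN; rewrite NE muln_gt0 => /andP[P0 d0].
have -> : \sum_(0 <= i < P * d) (P %| i)%:R * z ^+ (i * u)
          = \sum_(i < d) (z ^+ (P * u)) ^+ i.
  (* Induction on the number of blocks of [P] consecutive indices: in each block only the first
     index is a multiple of [P]. *)
  elim: (d) => [|e IH]; first by rewrite muln0 big_geq // big_ord0.
  rewrite big_ord_recr /= -IH mulnS addnC (@big_cat_nat _ _ _ (P * e)%N) ?leq_addr //=.
  congr (_ + _); rewrite -{1}[(P * e)%N]add0n big_addn addKn.
  rewrite big_ltn // big_nat_cond big1 ?addr0 => [|i /andP[/andP[i0 iP] _]].
    by rewrite add0n dvdn_mulr // mul1r -exprM; congr (_ ^+ _); rewrite mulnAC.
  by rewrite dvdn_addl ?dvdn_mulr // gtnNdvd // mul0r.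
have z1 : (z ^+ (P * u) == 1) = (d %| u)%N.
  by rewrite -(prim_order_dvd zN) NE dvdn_pmul2l.
case: (boolP (d %| u)%N) => [du|du].
  move: z1; rewrite du => /eqP z1; rewrite z1 mul1r.
  under eq_bigr do rewrite expr1n.
  by rewrite sumr_const card_ord.
have nz : z ^+ (P * u) - 1 != 0 by rewrite subr_eq0 z1.
rewrite mul0r; apply: (mulfI nz); rewrite mulr0 -subrX1 -exprM.
apply/eqP; rewrite subr_eq0 -(prim_order_dvd zN) NE -mulnA (mulnC u) mulnA.
exact: dvdn_mulr.
Qed.

(** * Sums over the factorisations of [m] *)

Lemma sum_factor_pairs (V : nmodType) (m : nat) (F : nat -> nat -> V) : (0 < m)%N ->
  \sum_(1 <= n < m.+1) \sum_(1 <= u < m.+1 | (n * u)%N == m) F n u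
  = \sum_(x : 'I_m.+1 * 'I_m.+1 | (x.1 * x.2 == m)%N) F x.1 x.2.
Proof.
move=> m0; rewrite -(pair_big_dep xpredT (fun n u : 'I_m.+1 => n * u == m)%N
  (fun n u : 'I_m.+1 => F n u)) /=.
rewrite -(big_mkord xpredT (fun n => \sum_(u < m.+1 | (n * u == m)%N) F n u)).
rewrite [RHS]big_ltn // [X in X + _]big1 => [|u]; last by rewrite mul0n ltn_eqF.
rewrite add0r; apply: eq_bigr => n _.
rewrite -(big_mkord (fun u => n * u == m)%N (F n)) [RHS]big_ltn_cond //.
by rewrite muln0 eq_sym gtn_eqF.
Qed.

(** The map sending [(n, u)] to [(u %/ d, d * n)] is an involution of the pairs with [n * u = m] and
    [d %| u], and it turns the weight [u] into [d * n]. *)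
Lemma sum_factor_pairs_swap (S : comNzSemiRingType) (m d : nat) : (0 < d)%N ->
  \sum_(1 <= n < m.+1) \sum_(1 <= u < m.+1 | (n * u)%N == m) (d %| u)%:R * u%:R
  = d%:R * \sum_(1 <= n < m.+1) \sum_(1 <= u < m.+1 | (n * u)%N == m)
             (d %| u)%:R * n%:R :> S.
Proof.
move=> d0; case: (posnP m) => [->|m0]; first by rewrite !big_geq ?mulr0.
rewrite !sum_factor_pairs // mulr_sumr.
pose f (x : 'I_m.+1 * 'I_m.+1) : 'I_m.+1 * 'I_m.+1 :=
  (inord (x.2 %/ d), inord (d * x.1)).
(* Both new coordinates are at most [m], so [inord] does not fall back to its default value on these
   pairs. *)
have bnd n u : (n * u = m -> d %| u -> (u %/ d < m.+1) /\ (d * n < m.+1))%N.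
  move=> e /dvdnP[v uE]; rewrite uE mulnK // !ltnS; move: e m0.
  rewrite uE => <-; rewrite !muln_gt0 => /and3P[n0 v0 _]; split.
    by rewrite mulnCA leq_pmulr // muln_gt0 n0.
  by rewrite mulnC leq_mul2l leq_pmull ?orbT.
have fE (x : 'I_m.+1 * 'I_m.+1) : (x.1 * x.2 = m)%N -> (d %| x.2)%N ->
  ((f x).1 = x.2 %/ d :> nat)%N /\ ((f x).2 = d * x.1 :> nat)%N.
  by move=> e dx; have [b1 b2] := bnd _ _ e dx; rewrite !inordK.
have fP (x : 'I_m.+1 * 'I_m.+1) : (x.1 * x.2 = m)%N -> (d %| x.2)%N ->
  [/\ ((f x).1 * (f x).2 = m)%N, (d %| (f x).2)%N & f (f x) = x].
  move=> e dx; have [e1 e2] := fE _ e dx.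
  have fm : ((f x).1 * (f x).2 = m)%N.
    by rewrite e1 e2 mulnA divnK // mulnC.
  have fd : (d %| (f x).2)%N by rewrite e2 dvdn_mulr.
  split=> //; have [e3 e4] := fE _ fm fd.
  rewrite [LHS]surjective_pairing [RHS]surjective_pairing.
  congr (_, _); apply: val_inj => /=; first by rewrite e3 e2 mulKn.
  by rewrite e4 e1 mulnC divnK.
have ind G : \sum_(x : 'I_m.+1 * 'I_m.+1 | (x.1 * x.2 == m)%N) ((d %| x.2)%:R * G x : S)
   = \sum_(x : 'I_m.+1 * 'I_m.+1 | (x.1 * x.2 == m)%N && (d %| x.2)%N) G x.
  rewrite [RHS]big_mkcondr; apply: eq_bigr => x _.
  by case: (d %| x.2)%N; rewrite ?mul1r ?mul0r.
under [RHS]eq_bigr do rewrite mulrCA.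
rewrite !ind (reindex_onto f f) => [|x /andP[/eqP e dx]]; last by have [] := fP x e dx.
apply: eq_big => [x|x /andP[/andP[/eqP e dx] /eqP ff]].
  apply/andP/andP=> [[/andP[/eqP e dx] /eqP <-]|[/eqP e dx]].
    by have [-> -> _] := fP _ e dx.
  by have [-> -> ->] := fP _ e dx; rewrite !eqxx.
have [{}e {}dx _] := fP _ e dx; rewrite ff in e dx.
by have [_ ->] := fE _ e dx; rewrite natrM.
Qed.

(** * Products of powers of distinct primes *)

Lemma pairwise_coprime_prime_powers (r : nat) (p k : 'I_r -> nat) (J : {set 'I_r}) :
  (forall j, prime (p j)) -> injective p ->
  pairwise coprime [seq p j ^ k j | j <- index_enum 'I_r & j \in J]%N.
Proof.
move=> p_prime p_inj; rewrite pairwise_map.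
apply: sub_pairwise (_ : pairwise [rel i j | i != j] _); last first.
  by rewrite -uniq_pairwise filter_uniq ?index_enum_uniq.
move=> i j /= ij; apply: coprimeXl; apply: coprimeXr.
by rewrite prime_coprime // dvdn_prime2 // (inj_eq p_inj).
Qed.

Lemma dvdn_prod_primes (r : nat) (p : 'I_r -> nat) (J : {set 'I_r}) (i : nat) :
  (forall j, prime (p j)) -> injective p ->
  (\prod_(t in J) p t %| i)%N = [forall t in J, p t %| i]%N.
Proof.
move=> p_prime p_inj.
have := pairwise_coprime_prime_powers (fun=> 1%N) J p_prime p_inj.
under eq_map do rewrite expn1.
move=> /(@Gauss_dvd_prod _ _ (mem J) p i) H.
apply/H/forall_inP => [h t tJ|h t _ tJ]; last exact: h.
by apply: h; rewrite ?mem_index_enum.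
Qed.

Lemma totient_prod_pairwise_coprime (I : Type) (s : seq I) (F : I -> nat) :
  pairwise coprime [seq F i | i <- s] ->
  totient (\prod_(i <- s) F i) = (\prod_(i <- s) totient (F i))%N.
Proof.
elim: s => [|a s IH] /=; first by rewrite !big_nil.
move=> /andP[cop /IH {}IH]; rewrite !big_cons totient_coprime ?IH //.
by apply: (@coprime_prodr _ [::] xpredT); rewrite filter_predT.
Qed.

Lemma coprime_prod_prime_powers (r : nat) (p k : 'I_r -> nat) (i : nat) :
  (forall j, prime (p j)) -> (forall j, 0 < k j)%N ->
  coprime (\prod_(j < r) p j ^ k j) i = [forall j, ~~ (p j %| i)%N].
Proof.
move=> p_prime k_gt0; apply/idP/forallP => [cop j|h].
  apply/negP => pji; have : (p j %| gcdn (\prod_(j < r) p j ^ k j) i)%N.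
    by rewrite dvdn_gcd pji andbT (bigD1 j) //= dvdn_mulr // dvdn_exp.
  by rewrite (eqP cop) Euclid_dvd1.
apply: (big_ind (fun x => coprime x i)) => [|x y cx cy|j _].
- by rewrite coprime1n.
- by rewrite coprimeMl cx.
- by rewrite coprimeXl // prime_coprime.
Qed.

Lemma prodr_bool (S : comNzSemiRingType) (I : finType) (P b : pred I) :
  \prod_(t | P t) (b t)%:R = [forall (t | P t), b t]%:R :> S.
Proof.
case: (boolP [forall (t | P t), b t]) => [/forall_inP h|].
  by rewrite big1 // => t /h ->.
by rewrite negb_forall_in => /exists_inP[t Pt /negbTE bt]; rewrite (bigD1 t) //= bt mul0r.
Qed.

(** The second product is the cofactor [D J]; the boolean [t \in J] counts as 0 or 1, and the
    truncated subtraction is exact because [0 < k t]. *)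
Lemma prod_radical_mul_cofactor (r : nat) (p k : 'I_r -> nat) (J : {set 'I_r}) :
  (forall j, 0 < k j)%N ->
  (\prod_(j < r) p j ^ k j
   = \prod_(t in J) p t * \prod_(t < r) p t ^ (k t - (t \in J)))%N.
Proof.
move=> k_gt0; rewrite [X in (_ = X * _)%N]big_mkcond -big_split /=.
apply: eq_bigr => t _; case: ifP => _; last by rewrite mul1n subn0.
by rewrite -expnS subn1 prednK.
Qed.

(** * Expansion of the weights over sets of primes *)

Lemma sum_prime_weights_unity_root (F : fieldType) (r : nat) (p k : 'I_r -> nat)
    (z : F) (a b : 'I_r -> F) (u : nat) :
  (forall j, prime (p j)) -> injective p -> (forall j, 0 < k j)%N ->
  (\prod_(j < r) p j ^ k j)%N.-primitive_root z ->
  \sum_(0 <= i < \prod_(j < r) p j ^ k j)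
     (\prod_(t < r) (a t - b t * (p t %| i)%:R)) * z ^+ (i * u)
  = \sum_(J : {set 'I_r}) (\prod_(t < r) (if t \in J then - b t else a t))
       * ((\prod_(t < r) p t ^ (k t - (t \in J)) %| u)%:R
          * (\prod_(t < r) p t ^ (k t - (t \in J)))%:R).
Proof.
move=> p_prime p_inj k_gt0 zN.
under eq_bigr => i _.
  rewrite (_ : \prod_(t < r) _ = \sum_(J : {set 'I_r})
    (\prod_(t < r) (if t \in J then - b t else a t)) * (\prod_(t in J) p t %| i)%:R).
    rewrite mulr_suml; over.
  (* The divisibility term is put first so that [bigA_distr] selects it exactly on [J]. *)
  under eq_bigr do rewrite addrC; rewrite bigA_distr; apply: eq_bigr => J _.
  rewrite dvdn_prod_primes // -prodr_bool [X in _ * X]big_mkcond -big_split /=.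
  by apply: eq_bigr => t _; case: ifP => _; rewrite ?mulr1 ?mulNr.
rewrite exchange_big /=; apply: eq_bigr => J _.
under eq_bigr do rewrite -mulrA; rewrite -mulr_sumr; congr (_ * _).
exact: sum_unity_root_multiples zN (prod_radical_mul_cofactor p J k_gt0).
Qed.

(** [G] is left free so that one expansion serves both [sigma1] (with [G n u = u]) and [kappa1]
    (with [G n u = n]). *)
Lemma sum_prime_weights_factor_pairs (F : fieldType) (r : nat) (p k : 'I_r -> nat)
    (z : F) (a b : 'I_r -> F) (m : nat) (G : nat -> nat -> F) :
  (forall j, prime (p j)) -> injective p -> (forall j, 0 < k j)%N ->
  (\prod_(j < r) p j ^ k j)%N.-primitive_root z ->
  \sum_(0 <= i < \prod_(j < r) p j ^ k j)
     (\prod_(t < r) (a t - b t * (p t %| i)%:R))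
     * \sum_(1 <= n < m.+1) \sum_(1 <= u < m.+1 | (n * u)%N == m) z ^+ (i * u) * G n u
  = \sum_(J : {set 'I_r}) (\prod_(t < r) (if t \in J then - b t else a t))
       * ((\prod_(t < r) p t ^ (k t - (t \in J)))%:R
          * \sum_(1 <= n < m.+1) \sum_(1 <= u < m.+1 | (n * u)%N == m)
              (\prod_(t < r) p t ^ (k t - (t \in J)) %| u)%:R * G n u).
Proof.
move=> p_prime p_inj k_gt0 zN.
under eq_bigr do rewrite mulr_sumr.
under [RHS]eq_bigr do rewrite mulrA mulr_sumr.
rewrite exchange_big [RHS]exchange_big; apply: eq_bigr => n _ /=.
under eq_bigr do rewrite mulr_sumr.
under [RHS]eq_bigr do rewrite mulr_sumr.
rewrite exchange_big [RHS]exchange_big; apply: eq_bigr => u _ /=.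
under eq_bigr do rewrite mulrA.
rewrite -mulr_suml sum_prime_weights_unity_root // mulr_suml.
by apply: eq_bigr => J _; rewrite -!mulrA; congr (_ * _); rewrite mulrCA.
Qed.

(** Both sides expand over the same [J], with the same signs. On the left, swapping the factors
    produces a second [D J]; on the right it sits in the coefficient, since [p t ^ (k t).-1] for [t]
    in [J] and [p t ^ k t] otherwise are the local factors of [D J]. The form [1 - 1 * _] fits the
    general weight. *)
Lemma sum_coprime_weights_duality (F : fieldType) (r : nat) (p k : 'I_r -> nat)
    (z : F) (m : nat) :
  (forall j, prime (p j)) -> injective p -> (forall j, 0 < k j)%N ->
  (\prod_(j < r) p j ^ k j)%N.-primitive_root z ->
  \sum_(0 <= i < \prod_(j < r) p j ^ k j)
     (\prod_(t < r) (1 - 1 * (p t %| i)%:R))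
     * \sum_(1 <= n < m.+1) \sum_(1 <= u < m.+1 | (n * u)%N == m) z ^+ (i * u) * u%:R
  = \sum_(0 <= i < \prod_(j < r) p j ^ k j)
     (\prod_(t < r) ((p t ^ k t)%:R - (p t ^ (k t).-1)%:R * (p t %| i)%:R))
     * \sum_(1 <= n < m.+1) \sum_(1 <= u < m.+1 | (n * u)%N == m) z ^+ (i * u) * n%:R.
Proof.
move=> p_prime p_inj k_gt0 zN.
rewrite !sum_prime_weights_factor_pairs //; apply: eq_bigr => J _.
rewrite sum_factor_pairs_swap; last by rewrite prodn_gt0 // => t; rewrite expn_gt0 prime_gt0.
rewrite [LHS]mulrA; congr (_ * _).
rewrite natr_prod -big_split /=; apply: eq_bigr => t _.
by case: ifP => _; rewrite ?mulN1r ?mul1r ?subn1 ?subn0.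
Qed.

Lemma totient_prime_power_natr (S : pzRingType) (p k : nat) : prime p -> (0 < k)%N ->
  (totient (p ^ k))%:R = (p ^ k)%:R - (p ^ k.-1)%:R :> S.
Proof.
move=> p_prime k_gt0; rewrite totient_pfactor //.
rewrite -natrB ?leq_exp2l ?prime_gt1 ?leq_pred //.
rewrite -{2}[k]prednK // expnS -{3}[p]prednK ?prime_gt0 // mulSn.
by rewrite addKn.
Qed.

(** The sum is an expanded product whose factor at [t] is [totient (p t ^ k t)] or [p t ^ k t],
    according to whether [p t] divides [i]. *)
Lemma sum_divisibility_patterns (S : comNzRingType) (r : nat) (p k : 'I_r -> nat) (i : nat) :
  (forall j, prime (p j)) -> (forall j, 0 < k j)%N ->
  \sum_(I : {set 'I_r})
    ((\prod_(t in I) (totient (p t ^ k t))%:R) * (\prod_(s | s \notin I) (p s ^ k s)%:R)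
     * ([forall t in I, (p t %| i)%N] && [forall (s | s \notin I), ~~ (p s %| i)%N])%:R)
  = \prod_(t < r) ((p t ^ k t)%:R - (p t ^ (k t).-1)%:R * (p t %| i)%:R) :> S.
Proof.
move=> p_prime k_gt0.
transitivity (\prod_(t < r) ((totient (p t ^ k t))%:R * (p t %| i)%:R
                             + (p t ^ k t)%:R * (~~ (p t %| i)%N)%:R) : S).
  rewrite bigA_distr; apply: eq_bigr => I _.
  rewrite -mulnb natrM -!prodr_bool mulrACA -!big_split /= [RHS](bigID (mem I)) /=.
  congr (_ * _); apply: eq_bigr => t; first by move=> ->.
  by move=> /negbTE ->.
apply: eq_bigr => t _; case: (p t %| i)%N; rewrite !(mulr1, mulr0, addr0, add0r, subr0) //.
exact: totient_prime_power_natr.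
Qed.

(** * Return to [sigma1] and [kappa1], and conclusion *)

Lemma sigma1_natr (R : realType) (N i m : nat) : (1 < N)%N -> (i < N)%N ->
  sigma1 R (i%:R : 'Z_N) m
  = \sum_(1 <= n < m.+1) \sum_(1 <= u < m.+1 | (n * u)%N == m) eta R N ^+ (i * u) * u%:R.
Proof. by move=> N1 iN; rewrite /sigma1 val_Zp_nat // modn_small. Qed.

Lemma kappa1_natr (R : realType) (N i m : nat) : (1 < N)%N -> (i < N)%N ->
  kappa1 R (i%:R : 'Z_N) m
  = \sum_(1 <= n < m.+1) \sum_(1 <= u < m.+1 | (n * u)%N == m) eta R N ^+ (i * u) * n%:R.
Proof. by move=> N1 iN; rewrite /kappa1 val_Zp_nat // modn_small. Qed.

(** All powers of [eta] are 1 here, so this is the swap of factors with [d = 1]. *)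
Lemma sigma1_0_kappa1_0 (R : realType) (N m : nat) :
  sigma1 R (0 : 'Z_N) m = kappa1 R (0 : 'Z_N) m.
Proof.
rewrite /sigma1 /kappa1; have := sum_factor_pairs_swap R[i] m (ltn0Sn 0).
rewrite mul1r; under eq_bigr => n _ do under eq_bigr => u _ do rewrite dvd1n.
under [X in _ = X]eq_bigr => n _ do under eq_bigr => u _ do rewrite dvd1n.
move=> H; under eq_bigr => n _ do under eq_bigr => u _ do rewrite mul0n expr0.
by rewrite H; apply: eq_bigr => n _; apply: eq_bigr => u _; rewrite mul0n expr0.
Qed.

Theorem theorem7p2 (R : realType) (N r : nat) (p k : 'I_r -> nat)
  (N_ge2 : (2 <= N)%N)
  (p_prime : forall j, prime (p j))
  (p_distinct : injective p)
  (k_ge1 : forall j, (1 <= k j)%N)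
  (N_factor : N = (\prod_(j < r) p j ^ k j)%N)
  (m : nat) :
  \sum_(1 <= i < N | gcdn N i == 1%N) sigma1 R (i%:R : 'Z_N) m
    - (totient N)%:R * sigma1 R (0 : 'Z_N) m
  = \sum_(I : {set 'I_r})
      ((\prod_(t in I) (totient (p t ^ k t))%:R)
       * (\prod_(s | s \notin I) (p s ^ k s)%:R)
       * \sum_(1 <= i < N | [forall t in I, (p t %| i)%N]
                            && [forall (s | s \notin I), ~~ (p s %| i)%N])
           kappa1 R (i%:R : 'Z_N) m).
Proof.
have N0 : (0 < N)%N by apply: ltnW.
pose w i : R[i] := \prod_(t < r) ((p t ^ k t)%:R - (p t ^ (k t).-1)%:R * (p t %| i)%:R).
(* Every [p t] divides 0, so each factor of [w 0] is [totient (p t ^ k t)]. *)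
have w0 : w 0 = (totient N)%:R.
  have := pairwise_coprime_prime_powers k [set: 'I_r] p_prime p_distinct.
  under eq_filter do rewrite inE; rewrite filter_predT => cop.
  rewrite N_factor totient_prod_pairwise_coprime // natr_prod; apply: eq_bigr => t _.
  by rewrite dvdn0 mulr1 totient_prime_power_natr.
have -> : \sum_(1 <= i < N | gcdn N i == 1%N) sigma1 R (i%:R : 'Z_N) m
          = \sum_(0 <= i < N) w i * kappa1 R (i%:R : 'Z_N) m.
  have zN := eta_primitive R N0.
  transitivity (\sum_(0 <= i < N | coprime N i) sigma1 R (i%:R : 'Z_N) m).
    (* Starting at 0 adds nothing, since [gcdn N 0 = N] is not 1. *)
    by rewrite [RHS]big_ltn_cond // /coprime gcdn0 gtn_eqF.
  transitivity (\sum_(0 <= i < N) (\prod_(t < r) (1 - 1 * (p t %| i)%:R)) *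
                 sigma1 R (i%:R : 'Z_N) m).
    rewrite big_mkcond; apply: eq_bigr => i _.
    rewrite {1}N_factor coprime_prod_prime_powers //.
    transitivity ([forall j, ~~ (p j %| i)%N]%:R * sigma1 R (i%:R : 'Z_N) m).
      by case: ifP; rewrite ?mul1r ?mul0r.
    rewrite -(prodr_bool R[i] xpredT (fun t => ~~ (p t %| i)%N)) /=.
    congr (_ * _); apply: eq_bigr => t _.
    by case: (p t %| i)%N; rewrite mul1r ?subrr ?subr0.
  under eq_big_nat => i /andP[_ iN] do rewrite sigma1_natr //.
  under [RHS]eq_big_nat => i /andP[_ iN] do rewrite kappa1_natr //.
  (* Abstracting [eta R N] to a primitive root [z] keeps the factorisation of [N] from being
     substituted inside it. *)
  by rewrite /w; move: (eta R N) zN => z; rewrite N_factor => zN; exact: sum_coprime_weights_duality.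
(* The term [i = 0] cancels the subtracted totient term. *)
rewrite big_ltn // w0 sigma1_0_kappa1_0 addrC addKr.
under [RHS]eq_bigr do rewrite [X in _ * X]big_mkcond mulr_sumr.
(* With [i] outermost, the sum over [I] collapses to [w i]. *)
rewrite [RHS]exchange_big; apply: eq_bigr => i _ /=.
rewrite /w -sum_divisibility_patterns // mulr_suml; apply: eq_bigr => I _.
by case: ifP => _; rewrite ?mulr1 // !mulr0 mul0r.
Qed.
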